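(* For every integer $n\geq 1$, the following identities hold: (1) $15F_{2(2n-1)}=5\cdot4^n-20\cdot4^{-n}+11\sum_{k=1}^{n-1}\bigl(4^{k}-4^{-k}\bigr)F_{2(2n-2k-1)}$; (2) $15F_{4n}=12\bigl(4^n-4^{-n}\bigr)+11\sum_{k=1}^{n-1}\bigl(4^{k}-4^{-k}\bigr)F_{4(n-k)}$; (3) $15F_{2n}=4\bigl(4^n-4^{-n}\bigr)-5\sum_{k=1}^{n-1}\bigl(4^{k}-4^{-k}\bigr)F_{2(n-k)}$; (4) $15L_{4(n-1)}=4^n+104\cdot4^{-n}+11\sum_{k=1}^{n-1}\bigl(4^{k}-4^{-k}\bigr)L_{4(n-k-1)}$; (5) $15L_{2(2n-1)}=9\cdot4^n+36\cdot4^{-n}+11\sum_{k=1}^{n-1}\bigl(4^{k}-4^{-k}\bigr)L_{2(2n-2k-1)}$; (6) $3L_{2n-2}=4^n+8\cdot4^{-n}-\sum_{k=0}^{n-1}\bigl(4^{k}-4^{-k}\bigr)L_{2(n-k-1)}$.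
   Context: $F_n$ and $L_n$ denote the Fibonacci and Lucas numbers: $F_0=0$, $F_1=1$, $L_0=2$, $L_1=1$, each satisfying $w_n=w_{n-1}+w_{n-2}$ for $n\ge 2$. A sum whose upper limit is smaller than its lower limit is $0$. *)

(* Defs.v *)
From mathcomp Require Import all_boot.

Set Implicit Arguments.
Unset Strict Implicit.
Unset Printing Implicit Defensive.

Fixpoint fib (n : nat) : nat :=
  match n with
  | 0 => 0
  | 1 => 1
  | (m.+1 as p).+1 => fib p + fib m
  end.

Fixpoint lucas (n : nat) : nat :=
  match n with
  | 0 => 2
  | 1 => 1
  | (m.+1 as p).+1 => lucas p + lucas m
  end.

(* Main.v *)
(* If a and u satisfy a_(k+2) = P a_(k+1) - a_k and u_(k+2) = Q u_(k+1) - u_k, the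
   denominators of their generating functions differ by (Q - P) x, so the
   convolution of u and a times Q - P is a combination of u and a.  All six
   identities are this fact for u_k = 4^k - 4^-k, where Q = 17/4, and for a an
   arithmetic subsequence of fib or lucas of step 2 (P = 3) or step 4 (P = 7). *)

Require Import Defs.
From mathcomp Require Import all_boot all_order all_algebra.
From mathcomp Require Import zify ring lra.
Import Order.TTheory GRing.Theory Num.Theory.
Local Open Scope ring_scope.

(** Induction on [n] for all [a] at once: splitting off the last summand leaves the convolution of
    [u] with the shift of [a], which obeys the same recurrence. There [a 2 - P * a 1 = - a 0], and
    the recurrence of [u] absorbs the rest. *)
Lemma convolution_order2 (R : comPzRingType) (P Q : R) (u a : nat -> R) (n : nat) :
  u 0 = 0 -> (forall k, u k.+2 = Q * u k.+1 - u k) ->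
  (forall k, a k.+2 = P * a k.+1 - a k) ->
  (Q - P) * (\sum_(0 <= k < n.+1) u k * a (n - k)%N) =
    a 0 * u n.+1 + (a 1 - P * a 0) * u n - u 1 * a n.
Proof.
move=> u0 uS; elim: n a => [|n IHn] a aS.
  by rewrite big_nat1 u0; ring.
rewrite big_nat_recr //= subnn.
rewrite (eq_big_nat _ _ (F2 := fun k => u k * a (n - k).+1)); last first.
  by move=> k /andP[_ lt_kn]; rewrite subSn.
rewrite mulrDr (IHn (fun k => a k.+1)) // aS uS; ring.
Qed.

(** The convolution identity times 4, solved for [a n]: 15 is [4 * u 1], and [17 - 4 * P] is
    [4 * (Q - P)]. The summand [k = 0] drops out because [u 0 = 0]. *)
Lemma pow4_convolution (P : rat) (a : nat -> rat) (n : nat) :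
  (forall k, a k.+2 = P * a k.+1 - a k) ->
  15 * a n = 4 * a 0 * (4 ^+ n.+1 - 4 ^- n.+1)
    + 4 * (a 1 - P * a 0) * (4 ^+ n - 4 ^- n)
    - (17 - 4 * P) * \sum_(1 <= k < n.+1) (4 ^+ k - 4 ^- k) * a (n - k)%N.
Proof.
move=> aS; pose u k : rat := 4 ^+ k - 4 ^- k.
have u0 : u 0 = 0 by rewrite /u expr0 invr1 subrr.
have uS k : u k.+2 = 17 / 4 * u k.+1 - u k.
  by rewrite /u !exprS !invfM; field; rewrite expf_neq0.
have := convolution_order2 _ _ _ _ _ n u0 uS aS.
rewrite big_ltn // u0 mul0r add0r (_ : u 1 = 15 / 4) // /u.
set S := \sum_(1 <= k < n.+1) _; lra.
Qed.

(** The squares of the roots of x^2 = x + 1 have sum 3 and product 1, so [P = 3] and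
    [17 - 4 * P = 5]. *)
Lemma fib_rec_step2_convolution (w : nat -> nat) (n : nat) :
  (forall m, w m.+2 = (w m.+1 + w m)%N) ->
  15 * (w (2 * n)%N)%:R =
    4 * (w 0)%:R * (4 ^+ n.+1 - 4 ^- n.+1)
    + 4 * ((w 2)%:R - 3 * (w 0)%:R) * (4 ^+ n - 4 ^- n)
    - 5 * \sum_(1 <= k < n.+1) (4 ^+ k - 4 ^- k) * (w (2 * (n - k))%N)%:R :> rat.
Proof.
move=> wS; rewrite (pow4_convolution 3 (fun k => (w (2 * k)%N)%:R)); first by ring.
by move=> k; rewrite !mulnS !addSn !add0n !wS !natrD; ring.
Qed.

(** The fourth powers of the same roots have sum 7 and product 1, whence [17 - 4 * 7 = -11]. The
    offset [r] serves both residues 0 and 2 of the index mod 4. *)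
Lemma fib_rec_step4_convolution (w : nat -> nat) (n r : nat) :
  (forall m, w m.+2 = (w m.+1 + w m)%N) ->
  15 * (w (4 * n + r)%N)%:R =
    4 * (w r)%:R * (4 ^+ n.+1 - 4 ^- n.+1)
    + 4 * ((w (4 + r)%N)%:R - 7 * (w r)%:R) * (4 ^+ n - 4 ^- n)
    + 11 * \sum_(1 <= k < n.+1) (4 ^+ k - 4 ^- k) * (w (4 * (n - k) + r)%N)%:R
    :> rat.
Proof.
move=> wS.
rewrite (pow4_convolution 7 (fun k => (w (4 * k + r)%N)%:R)); first by ring.
by move=> k; rewrite !mulnS !addSn !add0n !wS !natrD; ring.
Qed.

Theorem corollary9 (n : nat) (n_ge1 : (1 <= n)%N) :
  [/\ 15 * (fib (2 * (2 * n - 1)))%:R =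
        5 * 4 ^+ n - 20 * 4 ^- n
        + 11 * \sum_(1 <= k < n)
            (4 ^+ k - 4 ^- k) * (fib (2 * (2 * n - 2 * k - 1)))%:R :> rat,
      15 * (fib (4 * n))%:R =
        12 * (4 ^+ n - 4 ^- n)
        + 11 * \sum_(1 <= k < n)
            (4 ^+ k - 4 ^- k) * (fib (4 * (n - k)))%:R :> rat
    & 15 * (fib (2 * n))%:R =
        4 * (4 ^+ n - 4 ^- n)
        - 5 * \sum_(1 <= k < n)
            (4 ^+ k - 4 ^- k) * (fib (2 * (n - k)))%:R :> rat]
  /\
  [/\ 15 * (lucas (4 * (n - 1)))%:R =
        4 ^+ n + 104 * 4 ^- n
        + 11 * \sum_(1 <= k < n)
            (4 ^+ k - 4 ^- k) * (lucas (4 * (n - k - 1)))%:R :> rat,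
      15 * (lucas (2 * (2 * n - 1)))%:R =
        9 * 4 ^+ n + 36 * 4 ^- n
        + 11 * \sum_(1 <= k < n)
            (4 ^+ k - 4 ^- k) * (lucas (2 * (2 * n - 2 * k - 1)))%:R :> rat
    & 3 * (lucas (2 * n - 2))%:R =
        4 ^+ n + 8 * 4 ^- n
        - \sum_(0 <= k < n)
            (4 ^+ k - 4 ^- k) * (lucas (2 * (n - k - 1)))%:R :> rat].

Proof.
case: n n_ge1 => // n _.
have fibS m : fib m.+2 = (fib m.+1 + fib m)%N by [].
have lucasS m : lucas m.+2 = (lucas m.+1 + lucas m)%N by [].
have pow4S m : 4 ^+ m.+1 = 4 * 4 ^+ m :> rat by rewrite exprS.
have pow4NS m : 4 ^- m.+1 = 4^-1 * 4 ^- m :> rat by rewrite exprS invfM.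
have sum_eq (f g : nat -> nat) : (forall k, 1 <= k < n.+1 -> f k = g k)%N ->
    \sum_(1 <= k < n.+1) (4 ^+ k - 4 ^- k) * (f k)%:R
      = \sum_(1 <= k < n.+1) (4 ^+ k - 4 ^- k) * (g k)%:R :> rat.
  by move=> fg; apply: eq_big_nat => k /fg ->.
split; split.
(* With [n.+1] in place of [n] the index is [4 * n + 2], so the instance at [n] already has the
   right range of summation. *)
- have := fib_rec_step4_convolution _ n 2 fibS.
  rewrite (_ : 2 * (2 * n.+1 - 1) = 4 * n + 2)%N; last by lia.
  rewrite (sum_eq (fun k => fib (2 * (2 * n.+1 - 2 * k - 1)))
    (fun k => fib (4 * (n - k) + 2))) => [|k lt_k]; last by congr fib; lia.
  set S := \sum_(_ <= _ < _) _; rewrite pow4NS pow4S /=; lra.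
(* Here the instance is at [n.+1], whose sum has one summand too many; it carries [fib 0 = 0], which
   also removes the term in 4^(n+2). *)
- have := fib_rec_step4_convolution _ n.+1 0 fibS.
  rewrite big_nat_recr // subnn addn0; set F := fib (4 * n.+1); rewrite /=.
  rewrite (sum_eq (fun k => fib (4 * (n.+1 - k)))
    (fun k => fib (4 * (n.+1 - k) + 0))) => [|k _]; last by rewrite addn0.
  set S := \sum_(_ <= _ < _) _; lra.
- have := fib_rec_step2_convolution _ n.+1 fibS.
  rewrite big_nat_recr // subnn; set F := fib (2 * n.+1); rewrite /=.
  set S := \sum_(_ <= _ < _) _; lra.
- have := fib_rec_step4_convolution _ n 0 lucasS.
  rewrite subn1 /= addn0.
  rewrite (sum_eq (fun k => lucas (4 * (n.+1 - k - 1)))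
    (fun k => lucas (4 * (n - k) + 0))) => [|k lt_k]; last by congr lucas; lia.
  set S := \sum_(_ <= _ < _) _; rewrite pow4NS pow4S /=; lra.
- have := fib_rec_step4_convolution _ n 2 lucasS.
  rewrite (_ : 2 * (2 * n.+1 - 1) = 4 * n + 2)%N; last by lia.
  rewrite (sum_eq (fun k => lucas (2 * (2 * n.+1 - 2 * k - 1)))
    (fun k => lucas (4 * (n - k) + 2))) => [|k lt_k]; last by congr lucas; lia.
  set S := \sum_(_ <= _ < _) _; rewrite pow4NS pow4S /=; lra.
(* With u_k = 4^k - 4^-k, the boundary terms 8 u_(n+1) - 12 u_n equal 5 (4^(n+1) + 8 / 4^(n+1)), so
   the whole identity is divided by 5. The extra summand [k = 0] is zero. *)
- have := fib_rec_step2_convolution _ n lucasS.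
  rewrite (_ : 2 * n.+1 - 2 = 2 * n)%N; last by lia.
  rewrite [\sum_(0 <= k < _) _]big_ltn // expr0 invr1 subrr mul0r add0r.
  rewrite (sum_eq (fun k => lucas (2 * (n.+1 - k - 1)))
    (fun k => lucas (2 * (n - k)))) => [|k lt_k]; last by congr lucas; lia.
  set S := \sum_(_ <= _ < _) _; rewrite pow4NS pow4S /=; lra.
Qed.
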